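(* Let $(X,d)$ be a compact connected metric space and let $\phi$ be a continuous chain recurrent flow on $X$ having shadowable points, i.e. $Sh(\phi)\ne\emptyset$. Then $\phi$ is transitive.
   Context: A flow on $X$ is a map $\phi:X\times\mathbb{R}\to X$ with $\phi(x,0)=x$ and $\phi(\phi(x,s),t)=\phi(x,s+t)$, assumed continuous; $\phi_t(x)=\phi(x,t)$. The flow is transitive if there is $x\in X$ with $\omega(x)=X$, where $\omega(x)=\{y\in X: y=\lim_{n\to\infty}\phi_{t_n}(x)\text{ for some sequence }t_n\to+\infty\}$. Given $\delta,T>0$, a $(\delta,T)$-chain is a finite sequence $(x_i,t_i)_{i=0}^m$ in $X\times\mathbb{R}$ with $t_i\ge T$ and $d(\phi_{t_i}(x_i),x_{i+1})\le\delta$ for $0\le i\le m-1$. A point $p$ is chain recurrent if for all $\delta,T>0$ there is a $(\delta,T)$-chain $(x_i,t_i)_{i=0}^m$ with $m\ge1$ and $x_0=x_m=p$. The flow is chain recurrent if every point of $X$ is chain recurrent. A $(\delta,T)$-pseudo-orbit is a sequence $(x_i,t_i)_{i\in\mathbb{Z}}$ in $X\times\mathbb{R}$ with $t_i\ge T$ and $d(\phi_{t_i}(x_i),x_{i+1})\le\delta$ for all $i\in\mathbb{Z}$. It passes through $p$ if $x_0=p$. Put $s_0=0$, $s_i=\sum_{j=0}^{i-1}t_j$ for $i>0$, $s_i=-\sum_{j=i}^{-1}t_j$ for $i<0$, and $x_0\star t=\phi_{t-s_i}(x_i)$ whenever $s_i\le t<s_{i+1}$. $\mathrm{Rep}$ is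 the set of surjective strictly increasing maps $h:\mathbb{R}\to\mathbb{R}$ with $h(0)=0$. The pseudo-orbit is $\varepsilon$-shadowed if there are $y\in X$ and $h\in\mathrm{Rep}$ with $d(x_0\star t,\phi_{h(t)}(y))\le\varepsilon$ for all $t\in\mathbb{R}$. A point $p\in X$ is shadowable if for every $\varepsilon>0$ there is $\delta>0$ such that every $(\delta,1)$-pseudo-orbit passing through $p$ is $\varepsilon$-shadowed; $Sh(\phi)$ is the set of shadowable points. *)

(* Defs.v *)
From HB Require Import structures.
From mathcomp Require Import all_boot all_order all_algebra.
From mathcomp Require Import all_classical all_reals all_analysis.

Set Implicit Arguments.
Unset Strict Implicit.
Unset Printing Implicit Defensive.

Import Order.TTheory GRing.Theory Num.Theory.
Import numFieldTopology.Exports numFieldNormedType.Exports.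

Local Open Scope classical_set_scope.
Local Open Scope ring_scope.

Section Flows.
Context {R : realType} {X : metricType R}.
Implicit Types (phi : X * R -> X) (p x : X).

(* Continuity is joint: [X * R] carries the product topology. *)
Definition is_flow phi : Prop :=
  [/\ continuous phi,
      forall x, phi (x, 0) = x
    & forall x s t, phi (phi (x, s), t) = phi (x, s + t)].

Definition omega_limit phi x : set X :=
  [set y | exists2 u : nat -> R, u n @[n --> \oo] --> +oo
                               & phi (x, u n) @[n --> \oo] --> y].

Definition transitive_flow phi : Prop :=
  exists x, omega_limit phi x = [set: X].

(* The chain (x_i, t_i), 0 <= i <= m: the values of [xs] beyond m and of [ts]
   beyond m - 1 are irrelevant. *)
Definition is_chain phi (delta T : R) (m : nat) (xs : nat -> X) (ts : nat -> R)
    : Prop :=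
  forall i, (i < m)%N ->
    T <= ts i /\ mdist (phi (xs i, ts i)) (xs i.+1) <= delta.

Definition chain_recurrent_point phi p : Prop :=
  forall delta T : R, 0 < delta -> 0 < T ->
  exists (m : nat) (xs : nat -> X) (ts : nat -> R),
    [/\ (1 <= m)%N, is_chain phi delta T m xs ts, xs 0%N = p & xs m = p].

Definition chain_recurrent_flow phi : Prop :=
  forall p, chain_recurrent_point phi p.

Definition is_pseudo_orbit phi (delta T : R) (xs : int -> X) (ts : int -> R)
    : Prop :=
  forall i, T <= ts i /\ mdist (phi (xs i, ts i)) (xs (i + 1)) <= delta.

(* [Negz n] is -(n+1), so the second case is - (t_(-1) + ... + t_(-n-1)). *)
Definition switch_time (ts : int -> R) (i : int) : R :=
  match i with
  | Posz n => \sum_(j < n) ts (Posz j)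
  | Negz n => - \sum_(j < n.+1) ts (Negz j)
  end.

(* [xget] selects an index i with s_i <= u < s_(i+1); for a (delta, T)-pseudo-orbit
   with T > 0 this index exists and is unique, see [star_indexP]. *)
Definition star_index (ts : int -> R) (u : R) : int :=
  xget 0 [set i | switch_time ts i <= u < switch_time ts (i + 1)].

Definition star phi (xs : int -> X) (ts : int -> R) (u : R) : X :=
  let i := star_index ts u in phi (xs i, u - switch_time ts i).

Definition Rep : set (R -> R) :=
  [set h | [/\ set_surj [set: R] [set: R] h,
               {homo h : s t / s < t}
             & h 0 = 0]].

Definition shadowed phi (eps : R) (xs : int -> X) (ts : int -> R) : Prop :=
  exists y : X, exists2 h, Rep h &
    forall u, mdist (star phi xs ts u) (phi (y, h u)) <= eps.

Definition Sh phi : set X :=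
  [set p | forall eps : R, 0 < eps -> exists2 delta : R, 0 < delta &
    forall (xs : int -> X) (ts : int -> R),
      is_pseudo_orbit phi delta 1 xs ts -> xs 0 = p ->
      shadowed phi eps xs ts].

End Flows.

Section StarIndex.
Context {R : realType}.
Implicit Types (ts : int -> R) (T u : R).

Lemma switch_timeS ts i : switch_time ts (i + 1) = switch_time ts i + ts i.
Proof.
case: i => n.
  by rewrite -PoszD addn1 /= big_ord_recr.
have -> : Negz n + 1 = - n%:Z by rewrite NegzE -addn1 PoszD opprD addrK.
rewrite /= big_ord_recr /= opprD addrNK.
by case: n => [|n] /=; rewrite ?big_ord0 ?oppr0.
Qed.

Lemma switch_timeD T ts : (forall i, T <= ts i) -> forall i (n : nat),
  switch_time ts i + T *+ n <= switch_time ts (i + n%:Z).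
Proof.
move=> tT i; elim=> [|n IHn]; first by rewrite mulr0n !addr0.
by rewrite -addn1 PoszD addrA switch_timeS mulrnDr addrA lerD.
Qed.

Lemma star_indexP T ts u i : 0 < T -> (forall j, T <= ts j) ->
  switch_time ts i <= u < switch_time ts (i + 1) <-> star_index ts u = i.
Proof.
move=> T0 tT.
have uniq_index j k : switch_time ts j <= u < switch_time ts (j + 1) ->
    switch_time ts k <= u < switch_time ts (k + 1) -> j <= k.
  move=> /andP[ju _] /andP[_ uk]; rewrite leNgt; apply/negP => kj.
  suff : switch_time ts (k + 1) <= switch_time ts j.
    by rewrite leNgt (le_lt_trans ju uk).
  have jk : 0 <= j - (k + 1) by rewrite subr_ge0 -ltzD1 ltrD2r.
  have := switch_timeD tT (k + 1)%R `|(j - (k + 1))%R|%N.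
  rewrite gez0_abs // subrKC; apply: le_trans.
  by rewrite lerDl mulrn_wge0 // ltW.
have [k ku] : exists k, switch_time ts k <= u < switch_time ts (k + 1).
  have [n nu] : exists n : nat, u < T *+ n.
    exists (Num.truncn `|u / T|).+1.
    rewrite -mulr_natr mulrC -ltr_pdivrMr // (le_lt_trans (ler_norm _)) //.
    exact: truncnS_gt.
  have [m mu] : exists m : nat, - u < T *+ m.
    exists (Num.truncn `|- u / T|).+1.
    rewrite -mulr_natr mulrC -ltr_pdivrMr // (le_lt_trans (ler_norm _)) //.
    exact: truncnS_gt.
  have lo : switch_time ts (- m%:Z) <= u.
    have := switch_timeD tT (- m%:Z) m; rewrite addNr /= big_ord0.
    by rewrite -lerBrDr sub0r => /le_trans; apply; rewrite lerNl ltW.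
  have hi : exists k : nat, u < switch_time ts (- m%:Z + k%:Z).
    exists (m + n)%N; rewrite PoszD addKr.
    by apply: (lt_le_trans nu); have := switch_timeD tT 0 n;
       rewrite /= big_ord0 add0r.
  case: (ex_minnP hi) => -[|k]; first by rewrite addr0 ltNge lo.
  move=> ku kmin; exists (- m%:Z + k%:Z); apply/andP; split.
    by rewrite leNgt; apply/negP => /kmin; rewrite ltnn.
  by rewrite -addrA -PoszD addn1.
have su : switch_time ts (star_index ts u) <= u
            < switch_time ts (star_index ts u + 1).
  exact: (@xgetPex _ 0
    [set i | switch_time ts i <= u < switch_time ts (i + 1)] (ex_intro _ k ku)).
split=> [iu|<- //]; apply/eqP.
by rewrite eq_le !uniq_index.
Qed.

End StarIndex.

(* Main.v *)
Require Import Defs.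
From mathcomp Require Import all_boot all_order all_algebra.
From mathcomp Require Import all_classical all_reals all_analysis.
From Stdlib Require Import Relation_Operators Operators_Properties.

(** A single shadowable point [p] suffices because every pair of points can be
    joined by a pseudo-orbit that passes through [p].

    Chain recurrence and connectedness give, for each [delta], a chain of
    [delta]-jumps from any point to any other: the set of points reachable
    from [a] absorbs the [delta / 2]-ball around each of its points, since one
    can return to such a point along a [delta / 2]-chain and move the last
    landing point by [delta / 2]; hence it is clopen ([jumps_total]).  So for
    given [a] and [b] there are chains from [a] to [p] and from [p] to [b].
    Continued along orbits in both directions they form a pseudo-orbit through
    [p], and a point shadowing it passes near [a] and later near [b]
    ([shadowable_connects]).

    Since the time-[T] maps are homeomorphisms, this yields topological
    transitivity with arbitrarily long delays: for nonempty open [U] and [V]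
    some orbit goes from [U] to [V] in time at least [T] ([open_hits_open]).

    Topological transitivity becomes a point with full omega-limit set by
    Baire's theorem.  Compactness provides a finite [1 / (k + 1)]-net for each
    [k]; for each [k] and each point [y] of the [k]-th net, the points whose
    orbit comes within [1 / (k + 1)] of [y] after time [k] form an open dense
    set.  These sets are countably many, and any point common to them has
    full omega-limit set. *)

Set Implicit Arguments.
Unset Strict Implicit.
Unset Printing Implicit Defensive.

Import Order.TTheory GRing.Theory Num.Theory.
Import numFieldTopology.Exports numFieldNormedType.Exports.
Import metricType_numDomainType.

Local Open Scope classical_set_scope.
Local Open Scope ring_scope.

(** * Bi-infinite paths of a relation *)

(** The path is infinite, so after the given finite chain it goes on along a
    selector [f] of [E]. *)
Lemma clos_refl_trans_path (T : Type) (E : T -> T -> Prop) (f : T -> T) a b :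
  (forall x, E x (f x)) -> clos_refl_trans T E a b ->
  exists u : nat -> T,
    [/\ u 0%N = a, exists m, u m = b & forall i, E (u i) (u i.+1)].
Proof.
move=> Ef ab.
elim: {ab}(clos_rt_rt1n _ _ _ _ ab) => {a b} [a|a b c Eab _].
  by exists (fun i => iter i f a); split=> //; exists 0%N.
move=> [u [u0 [m um] Eu]].
exists (fun i => if i is k.+1 then u k else a).
split=> //; first by exists m.+1.
by case=> [|i] //=; rewrite u0.
Qed.

Lemma clos_refl_trans_flip (T : Type) (E : T -> T -> Prop) a b :
  clos_refl_trans T E a b -> clos_refl_trans T (fun x y => E y x) b a.
Proof.
elim=> [x y Exy|x|x y z _ yx _ zy]; [exact: rt_step|exact: rt_refl|].
exact: rt_trans zy yx.
Qed.

(** The two chains are glued at [p], which gets index 0: the one from [p] is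
    continued forwards by [f], the one to [p] backwards by [g]. *)
Lemma clos_refl_trans_bipath (T : Type) (E : T -> T -> Prop) (f g : T -> T)
    a p b :
  (forall x, E x (f x)) -> (forall x, E (g x) x) ->
  clos_refl_trans T E a p -> clos_refl_trans T E p b ->
  exists u : int -> T,
    [/\ u 0 = p, exists m : nat, u (- m%:Z) = a, exists n : nat, u n%:Z = b
      & forall i, E (u i) (u (i + 1))].
Proof.
move=> Ef Eg ap pb.
have [w [w0 [m wm] Ew]] := clos_refl_trans_path (E := fun x y => E y x) Eg
  (clos_refl_trans_flip ap).
have [v [v0 [n vn] Ev]] := clos_refl_trans_path Ef pb.
pose u (i : int) := match i with Posz k => v k | Negz k => w k.+1 end.
have uN k : u (- k%:Z) = w k by case: k => [|k] //=; rewrite v0 w0.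
exists u; split; [exact: v0|by exists m; rewrite uN|by exists n|].
case=> k; first by rewrite -PoszD addn1; exact: Ev.
have -> : Negz k + 1 = - k%:Z by rewrite NegzE -addn1 PoszD opprD addrK.
by rewrite uN; exact: Ew.
Qed.

(** * Compactness: Baire's theorem and finite nets *)

(** Regularity lets each nonempty open set be shrunk to an open set whose
    closure stays inside it and inside the next [F n]; a cluster point of the
    resulting decreasing sequence lies in all these closures. *)
Lemma compact_regular_Baire (T : topologicalType) (F : nat -> set T) :
  compact [set: T] -> regular_space T ->
  (forall i, open (F i) /\ dense (F i)) -> dense (\bigcap_i F i).
Proof.
move=> cptT regT odF O O0 oO.
have shrink (nV : nat * {V : set T | V !=set0 /\ open V}) :
    exists W : {V : set T | V !=set0 /\ open V},
      closure (sval W) `<=` sval nV.2 `&` F nV.1.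
  case: nV => n [V [V0 oV]] /=; have [oF dF] := odF n.
  have [x [Vx Fx]] := dF V V0 oV.
  have /regT[W Wx WVF] : nbhs x (V `&` F n).
    by apply: open_nbhs_nbhs; split=> //; exact: openI.
  have W'P : W° !=set0 /\ open W° by split; [exists x|exact: open_interior].
  exists (exist _ W° W'P) => /=; apply: subset_trans WVF.
  by apply: closure_subset; exact: interior_subset.
have [next nextP] := choice shrink.
pose fix W n := if n is k.+1 then next (k, W k)
                else exist _ O (conj O0 oO) : {V : set T | V !=set0 /\ open V}.
have WS n : closure (sval (W n.+1)) `<=` sval (W n) `&` F n by exact: nextP.
have Wle m n : (m <= n)%N -> sval (W n) `<=` sval (W m).
  elim: n => [|n IHn]; first by rewrite leqn0 => /eqP ->.
  rewrite leq_eqVlt => /predU1P[-> //|/IHn]; apply: subset_trans.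
  by move=> x /subset_closure/WS[].
have Wfilter : ProperFilter (filter_from [set: nat] (fun n => sval (W n))).
  apply: filter_from_proper => [|n _]; last by have [] := svalP (W n).
  apply: filter_from_filter => [|i j _ _]; first by exists 0%N.
  by exists (maxn i j) => // x Wx; split; apply: Wle Wx;
    rewrite ?leq_maxl ?leq_maxr.
have [x [_ Wx]] := cptT _ Wfilter (ex_intro2 _ _ 0%N I (fun _ _ => I)).
have {}Wx n : (sval (W n) `&` F n) x.
  apply: WS => B Bx.
  by apply: Wx => //; exists n.+1.
by exists x; split; [have [] := Wx 0%N|move=> n _; have [] := Wx n].
Qed.

(** Near-covering compactness for the filter of all sufficiently large finite
    sequences: near [x], every sequence that contains [x] is a net, so some
    sequence is a net everywhere. *)
Lemma compact_finite_net (R : realType) (X : metricType R) (e : R) :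
  compact [set: X] -> 0 < e ->
  exists s : seq X, forall x, exists2 y, y \in s & mdist y x < e.
Proof.
move=> /compact_near_coveringP cptX e0.
pose F := filter_from [set: seq X]
  (fun s => [set s' : seq X | {subset s <= s'}]).
have FF : Filter F.
  apply: filter_from_filter; first by exists [::].
  move=> s1 s2 _ _; exists (s1 ++ s2) => // s /= ss.
  by split=> x xs; apply: ss; rewrite mem_cat xs ?orbT.
have [|s _ /(_ s)] :=
    cptX _ F (fun s x => exists2 y, y \in s & mdist y x < e) FF.
  move=> x _; exists (ball x e, [set s : seq X | {subset [:: x] <= s}]).
    by split; [exact: nbhsx_ballx|exists [:: x]].
  move=> [x' s] /= []; rewrite ballEmdist => xx' xs; exists x => //.
  by apply: xs; rewrite mem_head.
by move=> /(_ (fun _ => id)) net; exists s => x; exact: net.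
Qed.

Lemma open_mdist_lt (R : realType) (X : metricType R) (y : X) (e : R) :
  open [set x | mdist y x < e].
Proof.
rewrite openE => x /= yx; apply/nbhs_mdistP; exists (e - mdist y x) => /=.
  by rewrite subr_gt0.
by move=> z /=; rewrite ltrBrDl; apply/le_lt_trans/metric_triangle.
Qed.

(** * Chains of jumps, shadowing and recurrence *)

Section ShadowableFlow.
Variables (R : realType) (X : metricType R) (phi : X * R -> X).
Hypothesis flow_phi : is_flow phi.

Let phi0 x : phi (x, 0) = x. Proof. by have [] := flow_phi. Qed.
Let phiD x s t : phi (phi (x, s), t) = phi (x, s + t).
Proof. by have [] := flow_phi. Qed.

Lemma continuous_time_map t : continuous (fun x => phi (x, t)).
Proof.
have [cphi _ _] := flow_phi => x.
have pairC : {for x, continuous (fun y => (y, t))}; last first.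
  exact: (continuous_comp pairC (cphi (x, t))).
exact: (cvg_pair (f := id) (g := cst t) cvg_id (cvg_cst t)).
Qed.

Definition jump (delta : R) (x y : X) : Prop :=
  exists2 t, 1 <= t & mdist (phi (x, t)) y <= delta.

Lemma jump_flow delta t x : 0 < delta -> 1 <= t -> jump delta x (phi (x, t)).
Proof. by move=> /ltW d0 t1; exists t => //; rewrite mdistxx. Qed.

Lemma chain_jumps delta m xs ts :
  is_chain phi delta 1 m xs ts ->
  clos_refl_trans X (jump delta) (xs 0%N) (xs m).
Proof.
elim: m => [_|m IHm chain]; first exact: rt_refl.
apply: rt_trans (IHm _) _.
  by move=> i im; apply: chain; rewrite ltnS ltnW.
by have [t1 d] := chain m (leqnn _); apply: rt_step; exists (ts m).
Qed.

(** A [delta / 2]-chain from [y] back to [y] has at least one jump, whose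
    landing point may be moved by [delta / 2]; perturbing the end of the chain
    from [a] to [y] itself would exceed [delta]. *)
Lemma jumps_near delta a y z : chain_recurrent_point phi y -> 0 < delta ->
  clos_refl_trans X (jump delta) a y -> mdist y z <= delta / 2 ->
  clos_refl_trans X (jump delta) a z.
Proof.
move=> cr_y d0 ay yz.
have d20 : 0 < delta / 2 by rewrite divr_gt0.
have [[|m] [xs [ts [// _ chain xs0 xsm]]]] := cr_y _ 1 d20 ltr01.
apply: rt_trans ay _.
have [t1 d] := chain m (leqnn _).
apply: (@rt_trans _ _ _ (xs m)).
  rewrite -xs0; apply: (@chain_jumps _ _ _ ts) => i im.
  have [? di] := chain i (ltnW im); split=> //; apply: (le_trans di).
  by rewrite ler_pdivrMr // ler_peMr ?ler1n // ltW.
apply: rt_step; exists (ts m) => //.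
apply: (le_trans (metric_triangle _ (xs m.+1) _)).
by rewrite [leRHS]splitr lerD // xsm.
Qed.

(** By [jumps_near] the points reachable from [a] form a set that is open and,
    as the radius [delta / 2] is the same at every point, also closed. *)
Lemma jumps_total delta a b : connected [set: X] -> chain_recurrent_flow phi ->
  0 < delta -> clos_refl_trans X (jump delta) a b.
Proof.
move=> connX cr_phi d0; have d20 : 0 < delta / 2 by rewrite divr_gt0.
pose B := [set y | clos_refl_trans X (jump delta) a y].
suff BT : B = setT by rewrite -[clos_refl_trans _ _ _ _]/(B b) BT.
apply: connX; first by exists a; exact: rt_refl.
- exists B; last by rewrite setTI.
  rewrite openE => y By; apply/nbhs_mdistP; exists (delta / 2) => // z /= /ltW.
  exact: jumps_near.
- exists B; last by rewrite setTI.
  move=> z /(_ (ball z (delta / 2)) (nbhsx_ballx _ _ d20))[y [By]].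
  by rewrite ballEmdist /= metric_sym => /ltW; exact: jumps_near.
Qed.

(** The points of a pseudo-orbit lie on its star trajectory, so shadowing
    controls them. *)
Lemma star_switch_time T xs ts i : 0 < T -> (forall j, T <= ts j) ->
  star phi xs ts (switch_time ts i) = xs i.
Proof.
move=> T0 tT; rewrite /star.
have -> : star_index ts (switch_time ts i) = i.
  apply/(star_indexP _ _ T0 tT).
  by rewrite lexx switch_timeS ltrDl (lt_le_trans T0).
by rewrite subrr phi0.
Qed.

(** The shadowing orbit meets the neighbourhoods of [a] and [b] in this order
    because [h] is increasing and [a] precedes [b] on the pseudo-orbit. *)
Lemma shadowable_connects p a b eps :
  connected [set: X] -> chain_recurrent_flow phi -> Sh phi p -> 0 < eps ->
  exists2 y, mdist a y <= eps &
    exists2 s, 0 <= s & mdist b (phi (y, s)) <= eps.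
Proof.
move=> connX cr_phi sh_p e0; have [delta d0 shadow] := sh_p _ e0.
(* Following the flow backwards for unit time gives an exact jump into [x]. *)
have back x : jump delta (phi (x, -1)) x.
  by exists 1 => //; rewrite phiD addNr phi0 mdistxx ltW.
have [xs [xs0 [m xsm] [n xsn] jumps]] := clos_refl_trans_bipath
  (fun x => jump_flow x d0 (lexx 1)) back
  (jumps_total a p connX cr_phi d0) (jumps_total p b connX cr_phi d0).
have [ts tsP] : exists ts : int -> R, is_pseudo_orbit phi delta 1 xs ts.
  have jumpT i : exists t,
      1 <= t /\ mdist (phi (xs i, t)) (xs (i + 1)) <= delta.
    by have [t t1 dt] := jumps i; exists t.
  by have [ts tsP] := choice jumpT; exists ts.
have ts1 j : 1 <= ts j by have [] := tsP j.
have [z [h [_ hmono _] zP]] := shadow _ _ tsP xs0.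
set sa := switch_time ts (- m%:Z); set sb := switch_time ts n%:Z.
have sab : sa <= sb.
  have := switch_timeD ts1 (- m%:Z) (m + n)%N; rewrite PoszD addKr.
  by apply: le_trans; rewrite lerDl mulrn_wge0.
exists (phi (z, h sa)).
  by have := zP sa; rewrite (star_switch_time xs _ ltr01 ts1) xsm.
exists (h sb - h sa); last first.
  by have := zP sb; rewrite phiD subrKC (star_switch_time xs _ ltr01 ts1) xsn.
rewrite subr_ge0; move: sab; rewrite le_eqVlt => /predU1P[-> //|/hmono].
exact: ltW.
Qed.

(** The delay is gained by aiming at the preimage of [V] under the time-[T]
    map, which is reached after a nonnegative time. *)
Lemma open_hits_open p (U V : set X) T :
  connected [set: X] -> chain_recurrent_flow phi -> Sh phi p ->
  open U -> U !=set0 -> open V -> V !=set0 ->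
  exists2 x, U x & exists2 t, T <= t & V (phi (x, t)).
Proof.
move=> connX cr_phi sh_p oU [a Ua] oV [b Vb].
pose W := (fun x => phi (x, T)) @^-1` V.
have oW : open W.
  by apply: open_comp => // x _; exact: continuous_time_map.
have Wb : W (phi (b, - T)) by rewrite /W /= phiD addNr phi0.
have /nbhs_mdistP[e1 /= e10 e1U] : nbhs a U by exact: open_nbhs_nbhs.
have /nbhs_mdistP[e2 /= e20 e2W] : nbhs (phi (b, - T)) W.
  exact: open_nbhs_nbhs.
have e0 : 0 < Num.min e1 e2 / 2 by rewrite divr_gt0 // lt_min e10.
have small : Num.min e1 e2 / 2 < Num.min e1 e2.
  by rewrite gtr_pMr ?lt_min ?e10 // invf_lt1 // ltr1n.
have [y ay [s s0 sb]] :=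
  shadowable_connects a (phi (b, - T)) connX cr_phi sh_p e0.
exists y.
  apply: e1U => /=.
  by rewrite (le_lt_trans ay) // (lt_le_trans small) // ge_min lexx.
exists (s + T); first by rewrite lerDr.
rewrite -phiD; apply: (e2W (phi (y, s))) => /=.
by rewrite (le_lt_trans sb) // (lt_le_trans small) // ge_min lexx orbT.
Qed.

Lemma omega_limit_setT x :
  (forall (n : nat) y,
    exists2 t, n%:R <= t & mdist y (phi (x, t)) < 2 / n.+1%:R) ->
  omega_limit phi x = setT.
Proof.
move=> visit; apply/seteqP; split=> // y _.
have visit_y (n : nat) : exists t,
    n%:R <= t /\ mdist y (phi (x, t)) < 2 / n.+1%:R.
  by have [t nt yt] := visit n y; exists t.
have [u uP] := choice visit_y.
exists u.
  apply: (ger_cvgy (f := fun n => n%:R)) cvgr_idn.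
  by apply: nearW => n; have [] := uP n.
apply/cvgrPdist_lt => e e0.
near=> n.
have [_ /lt_le_trans] := uP n; apply.
rewrite ler_pdivrMr // mulrC -ler_pdivrMr //.
rewrite (le_trans (ltW (truncnS_gt _))) // ler_nat ltnS.
by near: n; exact: nbhs_infty_ge.
Unshelve. all: by end_near. Qed.

End ShadowableFlow.

Theorem corollary2p17 (R : realType) (X : metricType R) (phi : X * R -> X)
    (cptX : compact [set: X]) (connX : connected [set: X])
    (flow_phi : is_flow phi) (cr_phi : chain_recurrent_flow phi)
    (sh_phi : Sh phi !=set0) :
  transitive_flow phi.
Proof.
have [p sh_p] := sh_phi.
have inv_gt0 k : 0 < k.+1%:R^-1 :> R by rewrite invr_gt0.
have [net netP] := choice (fun k => compact_finite_net cptX (inv_gt0 k)).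
(* Index [(k, j)] stands for the [j]-th point of the [k]-th net; [p] fills the
   indices [j] beyond its length. *)
pose visits k y :=
  [set x | exists2 t, k%:R <= t & mdist y (phi (x, t)) < k.+1%:R^-1].
pose F m :=
  let: (k, j) := odflt (0, 0)%N (unpickle m) in visits k (nth p (net k) j).
have odF m : open (F m) /\ dense (F m).
  rewrite /F; case: (odflt _ _) => k j; set y := nth _ _ _; split.
    have -> : visits k y = \bigcup_(t in [set t | k%:R <= t])
        (fun x => phi (x, t)) @^-1` [set z | mdist y z < k.+1%:R^-1] by [].
    apply: bigcup_open => t _; apply: open_comp; last exact: open_mdist_lt.
    by move=> x _; exact: continuous_time_map.
  move=> U U0 oU.
  have [|x Ux xt] := open_hits_open flow_phi k%:R connX cr_phi sh_p oU U0
    (@open_mdist_lt _ _ y k.+1%:R^-1).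
    by exists y => /=; rewrite mdistxx.
  by exists x.
have [x [_ Fx]] := compact_regular_Baire cptX uniform_regular odF
  (ex_intro _ p I) openT.
exists x; apply: omega_limit_setT => k y.
have [z znet zy] := netP k y.
have := Fx (pickle (k, index z (net k))) I.
rewrite /F pickleK /= nth_index // => -[t kt xt]; exists t => //.
apply: (le_lt_trans (metric_triangle _ z _)).
by rewrite mulrDl !mul1r ltrD // metric_sym.
Qed.
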